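(* Let $\Sigma_{\mathcal{F}}$ be a subshift of finite type over $\Sigma=\{0,1,\dots,q-1\}$ with $\mathcal{F}=\{a_1,\dots,a_s\}$ a minimal collection of forbidden words whose longest word has length $p\ge 2$, let $A$ be its adjacency matrix, and let $\theta$ be the Perron root of $A$. Then $\theta$ is the largest positive real zero in modulus of the rational function $(z-q)+r(z)$. Moreover, $(z-q)+r(z)$ has no zero outside the closed disk centered at the origin with radius $\theta$. Further, if $\Sigma_{\mathcal{F}}$ is irreducible, then $\theta$ is a simple zero of the rational function $(z-q)+r(z)$.
   Context: Let $q\ge 2$ and $\Sigma=\{0,1,\dots,q-1\}$. For a finite collection $\mathcal{F}$ of words over $\Sigma$ (each of length at least two), $\Sigma_{\mathcal{F}}\subset\Sigma^{\mathbb{N}}$ is the set of one-sided sequences containing no word of $\mathcal{F}$ as a (contiguous) subword. A word is allowed in $\Sigma_{\mathcal{F}}$ if it appears as a subword of some sequence in $\Sigma_{\mathcal{F}}$. The (non-empty) collection $\mathcal{F}=\{a_1,\dots,a_s\}$ of distinct words is minimal if all proper subwords of the words in $\mathcal{F}$ are allowed. Let $p\ge 2$ be the length of the longest word in $\mathcal{F}$. Adjacency matrix: $A$ is the $(0,1)$ matrix with rows and columns indexed by the allowed words of length $p-1$ (in lexicographic order), whose entry at $(x_1\dots x_{p-1},\,y_1\dots y_{p-1})$ is $1$ if and only if $x_2\dots x_{p-1}=y_1\dots y_{p-2}$ (no condition if $p=2$) and $x_1\dots x_{p-1}y_{p-1}$ is an allowed word of length $p$. $\Sigma_{\mathcal{F}}$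 is irreducible if $A$ is irreducible, i.e. for all $i,j$ there is $\ell\ge1$ with $(A^\ell)_{ij}>0$. The Perron root $\theta$ of $A$ is its spectral radius (an eigenvalue of $A$). Correlation: for words $x=x_1\dots x_{p_1}$ and $y=y_1\dots y_{p_2}$, the correlation polynomial is $(x,y)_z=\sum_{\ell=0}^{p_1-1}b_\ell z^{p_1-1-\ell}$, where $b_\ell=1$ if $x_{\ell+k}=y_k$ for all $1\le k\le \min(p_1-\ell,p_2)$, and $b_\ell=0$ otherwise. The correlation matrix of $\mathcal{F}$ is $\mathcal{M}(z)=[(a_j,a_i)_z]_{1\le i,j\le s}$ (the $(i,j)$ entry is $(a_j,a_i)_z$); its determinant is a non-zero polynomial. The rational function $r(z)$ is the sum of all entries of $\mathcal{M}(z)^{-1}$. Rational functions are considered in reduced form (removable singularities removed). *)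

(* Defs.v *)
From HB Require Import structures.
From mathcomp Require Import all_boot all_order all_algebra.
From mathcomp Require Import boolp classical_sets reals.
From mathcomp Require Import complex.

Set Implicit Arguments.
Unset Strict Implicit.
Unset Printing Implicit Defensive.

Import Order.TTheory GRing.Theory Num.Theory.

Local Open Scope ring_scope.
Local Open Scope complex_scope.

Definition occurs_in q (w : seq 'I_q) (x : nat -> 'I_q) : Prop :=
  exists n : nat, mkseq (fun k => x (n + k)%N) (size w) = w.

Definition in_subshift q (F : seq (seq 'I_q)) (x : nat -> 'I_q) : Prop :=
  forall a, a \in F -> ~ occurs_in a x.

Definition allowed q (F : seq (seq 'I_q)) (w : seq 'I_q) : Prop :=
  exists2 x, in_subshift F x & occurs_in w x.

Definition minimal_collection q (F : seq (seq 'I_q)) : Prop :=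
  [/\ F <> [::], uniq F, forall a, a \in F -> (2 <= size a)%N
    & forall a w, a \in F -> infix w a -> w <> a -> allowed F w].

Definition maxlen q (F : seq (seq 'I_q)) : nat := \max_(a <- F) size a.

Definition allowed_words q (F : seq (seq 'I_q)) (n : nat) :
    {set n.-tuple 'I_q} :=
  [set w : n.-tuple 'I_q | `[< allowed F w >]]%SET.

(* The canonical enumeration of n.-tuple 'I_q, hence that of any subset of it, *)
(* is in lexicographic order.                                                  *)
Definition allowed_word q (F : seq (seq 'I_q)) (n : nat)
    (i : 'I_#|allowed_words F n|) : seq 'I_q := tval (enum_val i).

(* With p = maxlen F, the words x and y have length p - 1, and                 *)
(* x ++ drop p.-2 y is x_1 ... x_{p-1} y_{p-1}.                                *)
Definition adjacency_mx (R : pzSemiRingType) q (F : seq (seq 'I_q)) :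
    'M[R]_#|allowed_words F (maxlen F).-1| :=
  \matrix_(i, j)
    let p := maxlen F in
    let x := allowed_word i in
    let y := allowed_word j in
    (`[< behead x = take p.-2 y /\ allowed F (x ++ drop p.-2 y) >])%:R.

Definition irreducible_mx (R : numDomainType) n (A : 'M[R]_n) : Prop :=
  forall i j, exists l : nat, (1 <= l)%N /\ 0 < (A ^+ l) i j.

Definition spectral_radius (R : realType) n (A : 'M[R]_n) : R :=
  sup (fun r : R => exists2 l : R[i],
         eigenvalue (map_mx (real_complex R) A) l & `|l| = r%:C).

(* Positions are 0-based: b_l compares x_{l+1} x_{l+2} ... with y_1 y_2 ...    *)
(* over the overlap.                                                           *)
Definition corr_coef q (x y : seq 'I_q) (l : nat) : bool :=
  let m := minn (size x - l) (size y) in take m (drop l x) == take m y.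

Definition corr_poly (C : nzRingType) q (x y : seq 'I_q) : {poly C} :=
  \sum_(l < size x) (corr_coef x y l)%:R *: 'X^((size x).-1 - l).

Definition corr_mx (C : nzRingType) q s (a : s.-tuple (seq 'I_q)) :
    'M[{poly C}]_s :=
  \matrix_(i, j) corr_poly C (tnth a j) (tnth a i).

Definition ratfun (C : fieldType) (n : {poly C}) : {fraction {poly C}} :=
  FracField.tofrac n.

(* If the determinant of corr_mx vanished, invmx would return its argument;   *)
(* this never happens for a minimal collection.                                *)
Definition corr_r (C : fieldType) q s (a : s.-tuple (seq 'I_q)) :
    {fraction {poly C}} :=
  let N := invmx (map_mx (@ratfun C) (corr_mx C a)) in
  \sum_(i < s) \sum_(j < s) N i j.

Definition forbidden_ratfun (C : fieldType) q s (a : s.-tuple (seq 'I_q)) :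
    {fraction {poly C}} :=
  ratfun ('X - q%:R%:P) + corr_r C a.

Definition reduced_form (C : fieldType) (f : {fraction {poly C}})
    (n d : {poly C}) : Prop :=
  [/\ d != 0, coprimep n d & f = ratfun n / ratfun d].

(* Reduced forms exist and are unique up to a common nonzero constant, so     *)
(* neither predicate below depends on the choice of n and d.                   *)
Definition is_zero_of (C : fieldType) (f : {fraction {poly C}}) (z : C) : Prop :=
  exists n d, reduced_form f n d /\ root n z.

Definition is_simple_zero_of (C : fieldType) (f : {fraction {poly C}}) (z : C) :
    Prop :=
  exists n d, [/\ reduced_form f n d, n != 0 & mup z n = 1%N].

(* Main.v *)
Require Import Defs.
From mathcomp Require Import all_boot all_order all_algebra.
From mathcomp Require Import boolp classical_sets reals.
From mathcomp Require Import complex.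

(** Write [f n] for the number of words of length [n] that avoid [F], and [g_a n]
    for the number of words of length [n] whose only forbidden subword is a final
    occurrence of [a]. Minimality enters in two ways. It makes [F] an antichain
    for the subword order, and it lets every avoiding word be continued to the
    right, so that avoiding words and allowed words are the same
    ([allowedE]).

    Adding one letter to an avoiding word, and adding a whole forbidden word to
    it, give the Guibas-Odlyzko relations between these numbers
    ([num_avoidingS], [num_avoiding_corr]); the positions where the second
    relation cuts a forbidden word are those recorded by the correlation
    polynomials. Solving the resulting linear system for the generating
    functions shows that [(z - q) + r(z)] is the inverse of
    [\sum_n f n / z^(n+1)].

    On the other hand the adjacency matrix [A] counts allowed words, so [f] and
    the [g_a] are linearly recurrent with characteristic polynomial
    [P = X^p * char_poly A]. A sequence [h] with such a recurrence has the
    generating function [gf_num P h / P], which is linear in [h] and turns the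
    shift of [h] into a multiplication by [X].
    With [U = gf_num P f] the conclusion is that [(z - q) + r(z) = P / U]
    ([forbidden_ratfun_avoiding]). Every zero of it is then [0] or an eigenvalue
    of [A], which gives the statement on the disk.

    It remains to see that [U / P] has a pole at the Perron root [theta], simple
    when [A] is irreducible. Up to terms that stay bounded and a power of [t],
    [U(t) / P(t)] is the sum of the entries of the solution [v] of
    [(t - A) v = 1]. For [t > theta] that solution is nonnegative
    ([resolvent_ge0]). The moduli of the coordinates of an eigenvector for an
    eigenvalue of modulus [theta] form a row [y >= 0] with [y A >= theta y];
    pairing it with [v] gives [y 1 <= (t - theta) y v], so the sum of [v] is at
    least [1 / (t - theta)]. If [A] is irreducible there is [x > 0] with
    [x A = theta x], and the same pairing bounds the sum by a constant over
    [t - theta]. Hence the pole has order at least one, and exactly one in the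
    irreducible case. *)

Set Implicit Arguments.
Unset Strict Implicit.
Unset Printing Implicit Defensive.

Import Order.TTheory GRing.Theory Num.Theory.

(** * Forbidden words and allowed words *)

Section Words.

Variables (q : nat).
Implicit Types (F : seq (seq 'I_q)) (u v w a b : seq 'I_q).

Definition avoids F w := ~~ has (fun a => infix a w) F.

Lemma avoids_infix F u w : infix u w -> avoids F w -> avoids F u.
Proof.
move=> uw; apply: contra => /hasP[a aF au].
by apply/hasP; exists a => //; apply: infix_trans uw.
Qed.

Lemma avoids_mem F a w : a \in F -> infix a w -> avoids F w = false.
Proof. by move=> aF aw; apply/negbTE/negPn/hasP; exists a. Qed.

Lemma avoids_rcons F w c :
  avoids F (rcons w c) =
  avoids F w && ~~ has (fun a => suffix a (rcons w c)) F.
Proof.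
rewrite /avoids -negb_or -has_predU; congr (~~ _).
by apply: eq_has => a /=; rewrite infix_rconsl orbC.
Qed.

Lemma occurs_in_infix u w x : infix u w -> occurs_in w x -> occurs_in u x.
Proof.
move=> /infixP[s1 [s2 ->]] [n nw]; exists (n + size s1)%N.
apply: (@eq_from_nth _ (x n)) => [|i]; rewrite size_mkseq // => i_lt.
have i_lt2 : (size s1 + i < size (s1 ++ u ++ s2))%N.
  by rewrite !size_cat ltn_add2l ltn_addr.
have := congr1 (fun t => nth (x n) t (size s1 + i)%N) nw.
rewrite !nth_mkseq // addnA => ->.
by rewrite nth_cat ltnNge leq_addr /= addKn nth_cat i_lt.
Qed.

Lemma occurs_in_rcons w x n :
  mkseq (fun k => x (n + k)%N) (size w) = w ->
  occurs_in (rcons w (x (n + size w)%N)) x.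
Proof. by move=> nw; exists n; rewrite size_rcons mkseqS nw. Qed.

Lemma allowed_avoids F w : allowed F w -> avoids F w.
Proof.
case=> x xF wx; apply/negP => /hasP[a aF aw].
by apply: (xF a aF); apply: occurs_in_infix wx.
Qed.

Variables (F : seq (seq 'I_q)) (hF : minimal_collection F).

Lemma forbidden_size a : a \in F -> (1 < size a)%N.
Proof. by case: hF => _ _ h _; apply: h. Qed.

(** Proper subwords of forbidden words are allowed, while forbidden words are
    not: hence a minimal collection is an antichain for the subword order. *)
Lemma forbidden_infix_eq a b : a \in F -> b \in F -> infix a b -> a = b.
Proof.
case: hF => _ _ _ h aF bF ab; case: (eqVneq a b) => // /eqP anb.
have := allowed_avoids (h b a bF ab anb).
by rewrite (avoids_mem aF (infix_refl a)).
Qed.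

Lemma avoids_nil : avoids F [::].
Proof.
apply/negP => /hasP[a aF]; rewrite infixs0 => /eqP a0.
by have := forbidden_size aF; rewrite a0.
Qed.

(** If every letter [c] completed a forbidden suffix of [rcons w c], take the
    longest of these forbidden words. It loses its last letter inside [w], so
    by minimality what remains can be followed by some letter [d]; but the
    forbidden suffix of [rcons w d] is not longer, so it is contained in that
    allowed word. *)
Lemma avoids_extend w : avoids F w -> exists c, avoids F (rcons w c).
Proof.
move=> wF; apply: contrapT => /forallNP noext.
have sfx c : exists a, (a \in F) && suffix a (rcons w c).
  have /negP := noext c; rewrite avoids_rcons wF /= negbK => /hasP[a aF aw].
  by exists a; rewrite aF.
have [g gP] := fin_all_exists sfx.
(* A point of the subshift, from which a first letter is taken: the empty word
   is a proper subword of a forbidden word. *)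
have [x0 xF0] : exists x, in_subshift F x.
  case: hF => F0 _ F2 h; case: F F0 F2 h => [//|a s _ F2 h].
  have [||x xF _] := h a [::] (mem_head _ _); rewrite ?infix0s //.
    by move=> a0; have := F2 a (mem_head _ _); rewrite -a0.
  by exists x.
pose c := [arg max_(i > x0 0) size (g i)]%N.
have cmax d : (size (g d) <= size (g c))%N.
  by rewrite /c; case: arg_maxnP => // i _; apply.
have /andP[gcF gcs] := gP c.
case/lastP E : (g c) gcF gcs => [|b c'] gcF.
  by have := forbidden_size gcF.
rewrite suffix_rcons => /andP[_ bw].
have [x xF [n nb]] : allowed F b.
- case: hF => _ _ _ h; apply: (h (rcons b c')) => //; first exact: infix_rcons.
  by move/(congr1 size)/eqP; rewrite size_rcons -[X in X == _]addn0 -addn1 eqn_add2l.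
pose d := x (n + size b)%N.
have /andP[gdF gds] := gP d.
have gdb : suffix (g d) (rcons b d).
  have /suffixP[t tE] : suffix (rcons b d) (rcons w d).
    by rewrite suffix_rcons eqxx.
  rewrite tE in gds; move: gds; rewrite suffixE => /eqP <-.
  have le : (size (g d) <= size (rcons b d))%N.
    by have := cmax d; rewrite E !size_rcons.
  rewrite size_cat -addnBA // drop_cat ltnNge leq_addr /= addKn.
  exact: suffix_drop.
by apply: (xF _ gdF); apply: occurs_in_infix (suffixW gdb) (occurs_in_rcons nb).
Qed.

(** Since the sequences are one-sided, extension to the right is enough for an
    avoiding word to be the beginning of a point of the subshift. *)
Lemma allowedE w : allowed F w <-> avoids F w.
Proof.
split=> [|wF]; first exact: allowed_avoids.
have ext (z : {v | avoids F v}) : exists c, avoids F (rcons (val z) c).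
  by apply: avoids_extend; apply: valP.
have {ext} [g gP] := choice ext.
pose next (z : {v | avoids F v}) : {v | avoids F v} := exist _ (rcons (val z) (g z)) (gP z).
pose W k : {v | avoids F v} := iter k next (exist _ w wF).
have WS k : val (W k.+1) = rcons (val (W k)) (g (W k)) by [].
have sizeW k : size (val (W k)) = (size w + k)%N.
  by elim: k => [|k IH]; rewrite ?addn0 // WS size_rcons IH addnS.
have [c _] := avoids_extend wF.
pose x n := nth c (val (W n.+1)) n.
have pfx k m i : (i < size w + k)%N ->
    nth c (val (W (k + m)%N)) i = nth c (val (W k)) i.
  move=> ik; elim: m => [|m IH]; rewrite ?addn0 // addnS WS nth_rcons sizeW.
  by rewrite (leq_trans ik) // addnA leq_addr.
have xW k i : (i < size w + k)%N -> x i = nth c (val (W k)) i.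
  move=> ik; rewrite /x -(pfx _ k); last by rewrite addnS ltnS leq_addl.
  by rewrite addnC (pfx k i.+1).
have xmk n k : mkseq (fun i => x (n + i)%N) k = take k (drop n (val (W (n + k)%N))).
  apply: (@eq_from_nth _ c) => [|i].
    by rewrite size_mkseq size_takel // size_drop sizeW addnCA addKn leq_addl.
  rewrite size_mkseq => ik; rewrite nth_mkseq // nth_take // nth_drop.
  by apply: xW; rewrite (leq_trans (n := n + k)) ?ltn_add2l // leq_addl.
exists x => [a aF [n na]|].
  have := valP (W (n + size a)%N); rewrite (avoids_mem aF) //.
  rewrite -{1}na xmk; apply: infix_trans (infix_drop _ n); exact: infix_take.
exists 0; rewrite xmk drop0 add0n.
apply: (@eq_from_nth _ c) => [|i]; rewrite size_takel ?sizeW ?leq_addl // => i_lt.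
by rewrite nth_take // -[X in W X]add0n pfx ?addn0.
Qed.

End Words.

(** * Counting words by their first forbidden subword *)

Lemma sum_tuple_rcons (T : finType) n (phi : seq T -> nat) :
  (\sum_(w : n.+1.-tuple T) phi w =
   \sum_(w : n.-tuple T) \sum_c phi (rcons w c))%N.
Proof.
pose h (p : n.-tuple T * T) : n.+1.-tuple T := [tuple of rcons p.1 p.2].
rewrite pair_big (reindex h) //=.
pose h' (w : n.+1.-tuple T) : n.-tuple T * T :=
  ([tuple of belast (thead w) (behead w)], last (thead w) (behead w)).
exists h' => [[w c] _|w _].
  rewrite /h' /h /=; congr (_, _).
    by apply: val_inj; case: w => -[|x w] i //=; rewrite /thead (tnth_nth x) /= belast_rcons.
  by case: w => -[|x w] i //=; rewrite last_rcons.
apply: val_inj; case: w => -[|x w] i //=.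
by rewrite -lastI /thead (tnth_nth x).
Qed.

Lemma sum_tuple_suffix (T : finType) n (u : seq T) (phi : seq T -> nat) :
    (forall w, phi w != 0 -> suffix u w)%N ->
  (\sum_(w : (n + size u).-tuple T) phi w = \sum_(w : n.-tuple T) phi (w ++ u))%N.
Proof.
elim/last_ind: u phi => [|u c IH] phi phiu.
  by rewrite addn0; apply: eq_bigr => w _; rewrite cats0.
rewrite size_rcons addnS sum_tuple_rcons.
have last_c (w : seq T) : (\sum_d phi (rcons w d) = phi (rcons w c))%N.
  rewrite (bigD1 c) //= big1 ?addn0 // => d dc; apply/eqP/negPn/negP => /phiu.
  by rewrite suffix_rcons eq_sym (negbTE dc).
under eq_bigr => w _ do rewrite last_c.
rewrite (IH (fun w => phi (rcons w c))); last first.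
  by move=> w /phiu; rewrite suffix_rcons eqxx.
by apply: eq_bigr => w _; rewrite rcons_cat.
Qed.

Section Counting.

Variables (q : nat) (F : seq (seq 'I_q)).
Implicit Types (u v w a b : seq 'I_q).

(** The proper prefixes of [w] avoid [F] as soon as the longest of them does:
    the first forbidden word met when [w] is read is [a], at the very end. *)
Definition first_hit a w := suffix a w && avoids F (take (size w).-1 w).

Definition num_avoiding n := (\sum_(w : n.-tuple 'I_q) avoids F w)%N.
Definition num_first_hit a n := (\sum_(w : n.-tuple 'I_q) first_hit a w)%N.

Lemma first_hit_rcons a w c :
  first_hit a (rcons w c) = suffix a (rcons w c) && avoids F w.
Proof. by rewrite /first_hit size_rcons -cats1 take_size_cat. Qed.

Hypothesis hF : minimal_collection F.

Lemma num_avoiding0 : num_avoiding 0 = 1%N.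
Proof.
rewrite /num_avoiding (bigD1 [tuple]) //= (avoids_nil hF) big1 // => w.
by rewrite tuple0.
Qed.

Lemma num_first_hit_small a n : (n < size a)%N -> num_first_hit a n = 0%N.
Proof.
move=> na; rewrite /num_first_hit big1 // => w _; rewrite /first_hit.
case: (boolP (suffix a w)) => // /size_suffix.
by rewrite size_tuple leqNgt na.
Qed.

(** Of two suffixes of a word one is a suffix of the other, and forbidden words
    form an antichain: so at most one of them ends the word. *)
Lemma avoids_step w c :
  avoids F w = (avoids F (rcons w c) + \sum_(a <- F) first_hit a (rcons w c))%N :> nat.
Proof.
have uF : uniq F by case: hF.
under eq_bigr => a _ do rewrite first_hit_rcons.
rewrite avoids_rcons; case: (avoids F w) => /=; last first.
  by rewrite big1 // => a _; rewrite andbF.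
case: hasP => [[a aF aw]|no]; last first.
  rewrite big1_seq ?addn0 // => a /= aF; rewrite andbT.
  by case: (boolP (suffix a _)) => // aw; case: no; exists a.
rewrite add0n (bigD1_seq a) //= aw big1_seq // => b /andP[ba bF]; rewrite andbT.
case: (boolP (suffix b _)) => // bw; case/eqP: ba.
wlog le_ab : a b aF aw bF bw / (size a <= size b)%N.
  move=> th; case: (leqP (size a) (size b)) => [|/ltnW] le; first exact: th.
  by apply/esym; apply: th.
apply/esym; apply: (forbidden_infix_eq hF) => //; apply: suffixW.
move: aw (bw) (size_suffix bw); rewrite !suffixE => /eqP aE /eqP bE sx.
by rewrite -{2}bE drop_drop addnC addnBA // subnK // aE.
Qed.

Lemma num_avoidingS n :
  (q * num_avoiding n =
   num_avoiding n.+1 + \sum_(a <- F) num_first_hit a n.+1)%N.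
Proof.
rewrite /num_avoiding /num_first_hit exchange_big /= -big_split /=.
rewrite (sum_tuple_rcons n
  (fun w : seq 'I_q => (avoids F w + \sum_(a <- F) first_hit a w)%N)).
rewrite big_distrr /=; apply: eq_bigr => w _.
under eq_bigr => c _ do rewrite -avoids_step.
by rewrite sum_nat_const card_ord.
Qed.

(** Reading [w ++ a] for an avoiding [w], exactly one forbidden word is met
    first, somewhere inside [a]: telescope [avoids_step] along [a]. *)
Lemma avoids_cat_forbidden a w : a \in F ->
  avoids F w = (\sum_(b <- F) \sum_(m < size a) first_hit b (w ++ take m.+1 a))%N :> nat.
Proof.
move=> aF.
have tele k : (k <= size a)%N ->
  avoids F w = (avoids F (w ++ take k a) +
     \sum_(b <- F) \sum_(m < k) first_hit b (w ++ take m.+1 a))%N :> nat.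
  elim: k => [|k IH] ka.
    by rewrite take0 cats0 big1 ?addn0 // => b _; rewrite big_ord0.
  have [c0 _] : exists c0 : 'I_q, True by case: (a) ka => // c0; exists c0.
  rewrite {1}IH 1?ltnW // (take_nth c0) // -rcons_cat (avoids_step _ (nth c0 a k)) -addnA.
  congr addn; rewrite addnC -big_split /=; apply: eq_bigr => b _.
  by rewrite [in RHS]big_ord_recr /= (take_nth c0) // rcons_cat.
rewrite (tele (size a)) // take_size (@avoids_mem q F a) //.
exact/suffixW/suffix_suffix.
Qed.

(** If [a] is cut after [m.+1] letters by a final occurrence of [b], then [b] is
    at least as long as this prefix, otherwise it would be a proper subword of
    [a]; the prefix is then a suffix of [b], which is what [corr_coef] tests. *)
Lemma sum_first_hit_cat a b n m : a \in F -> b \in F -> (m < size a)%N ->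
  (\sum_(w : n.-tuple 'I_q) first_hit b (w ++ take m.+1 a) =
   ((m < size b) && corr_coef b a (size b - m.+1)) * num_first_hit b (n + m.+1))%N.
Proof.
move=> aF bF ma; set u := take m.+1 a.
have su : size u = m.+1 by rewrite size_takel.
case: (boolP (_ && _)) => [/andP[mb]|no].
  rewrite /corr_coef subKn // (minn_idPl ma) take_oversize; last first.
    by rewrite size_drop subKn.
  move=> /eqP bu; rewrite mul1n -[in RHS]su /num_first_hit.
  rewrite (@sum_tuple_suffix _ n u (fun w => first_hit b w)) // => w.
  rewrite eqb0 negbK => /andP[bw _]; apply: suffix_trans bw.
  by rewrite /u -bu suffix_drop.
rewrite mul0n big1 // => w _; apply/eqP; rewrite eqb0; apply: contra no.
move=> /andP[bw _].
case: (ltnP m (size b)) => [mb|bm] /=.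
  rewrite /corr_coef subKn // (minn_idPl ma) take_oversize; last first.
    by rewrite size_drop subKn.
  have := suffix_trans (suffix_drop b (size b - m.+1)) bw.
  rewrite suffixE size_cat su size_drop subKn // addnK drop_size_cat //.
  by rewrite eq_sym.
have bu : suffix b u.
  move: bw; rewrite !suffixE size_cat su -addnBA ?(leq_trans bm) //.
  by rewrite drop_cat ltnNge leq_addr /= addKn.
have ab := forbidden_infix_eq hF bF aF (infix_trans (suffixW bu) (infix_take _ _)).
by rewrite ab leqNgt ma in bm.
Qed.

(** The position [l] at which [corr_coef b a] is read is that of the overlap of
    [b] with the copy of [a] appended to an avoiding word of length [n]. *)
Lemma num_avoiding_corr a n : a \in F ->
  (num_avoiding n = \sum_(b <- F) \sum_(l < size b)
     corr_coef b a l * num_first_hit b (n + (size b - l)))%N.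
Proof.
move=> aF; rewrite /num_avoiding.
under [LHS]eq_bigr => w _ do rewrite (avoids_cat_forbidden w aF).
rewrite exchange_big /=; apply: eq_big_seq => b bF.
rewrite exchange_big /= [RHS](reindex_inj rev_ord_inj) /=.
under eq_bigr => m _ do rewrite sum_first_hit_cat //.
under [RHS]eq_bigr => m _ do rewrite subKn //.
pose G m := (((m < size a) && (m < size b) && corr_coef b a (size b - m.+1)) *
              num_first_hit b (n + m.+1))%N.
rewrite (eq_bigr (fun m : 'I__ => G m)); last by move=> m _; rewrite /G ltn_ord.
rewrite [RHS](eq_bigr (fun m : 'I__ => G m)); last first.
  move=> m _; rewrite /G ltn_ord andbT; case: ltnP => //= am.
  rewrite /corr_coef subKn // (minn_idPr _) 1?leqW // take_size.
  case: eqP => // e; have ab : infix a b.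
    by rewrite -e; apply: infix_trans (infix_take _ _) (infix_drop _ _).
  by move: am; rewrite (forbidden_infix_eq hF aF bF ab) leqNgt ltn_ord.
rewrite (big_ord_widen (size a + size b) G) ?leq_addr //.
rewrite [RHS](big_ord_widen (size a + size b) G) ?leq_addl //.
rewrite big_mkcond [RHS]big_mkcond; apply: eq_bigr => m _; rewrite /G.
by case: (m < size a)%N; case: (m < size b)%N.
Qed.

End Counting.

(** * The adjacency matrix as a transfer matrix *)

Local Open Scope ring_scope.

Section Transfer.

Variables (K : comNzRingType) (q : nat) (F : seq (seq 'I_q)).
Hypothesis hF : minimal_collection F.
Implicit Types (u v w a : seq 'I_q).

Local Notation p := (maxlen F).
Local Notation A := (adjacency_mx K F).
Local Notation state := 'I_#|allowed_words F (maxlen F).-1|.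

Lemma leq_maxlen a : a \in F -> (size a <= p)%N.
Proof. by move=> aF; apply: leq_bigmax_seq. Qed.

Lemma maxlen_gt1 : (1 < p)%N.
Proof.
case: hF; case: F => [//|a s _ _ h _].
by rewrite (leq_trans (h a (mem_head _ _))) // /maxlen big_cons leq_maxl.
Qed.

Lemma size_allowed_word (i : state) : size (allowed_word i) = p.-1.
Proof. exact: size_tuple. Qed.

Lemma allowed_word_avoids (i : state) : avoids F (allowed_word i).
Proof.
apply: allowed_avoids; have := enum_valP i.
by rewrite inE => /asboolP.
Qed.

Lemma allowed_word_inj : injective (@allowed_word q F p.-1).
Proof. by move=> i j /val_inj /enum_val_inj. Qed.

Lemma allowed_word_onto w : size w = p.-1 -> avoids F w ->
  exists i : state, allowed_word i = w.
Proof.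
move=> /eqP sw wF.
have wA : Tuple sw \in allowed_words F p.-1 by rewrite inE; apply/asboolP/allowedE.
by exists (enum_rank_in wA (Tuple sw)); rewrite /allowed_word enum_rankK_in.
Qed.

Definition last_block w := drop (size w - p.-1) w.

Lemma suffix_allowed_word (i : state) w :
  suffix (allowed_word i) w = (allowed_word i == last_block w).
Proof. by rewrite suffixE size_allowed_word eq_sym. Qed.

Definition state_counts n : 'rV[K]_#|allowed_words F p.-1| :=
  \row_i (\sum_(w : n.-tuple 'I_q) (avoids F w && suffix (allowed_word i) w))%:R.

Lemma sum_state_counts n (Q : seq 'I_q -> K) : (p.-1 <= n)%N ->
  \sum_i state_counts n 0 i * Q (allowed_word i) =
  \sum_(w : n.-tuple 'I_q) (avoids F w)%:R * Q (last_block w).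
Proof.
move=> pn; under eq_bigr => i _ do rewrite mxE natr_sum mulr_suml.
rewrite exchange_big /=; apply: eq_bigr => w _.
case: (boolP (avoids F w)) => wF; last by rewrite mul0r big1 // => i _; rewrite mul0r.
have [||i iw] := @allowed_word_onto (last_block w).
- by rewrite size_drop size_tuple subKn.
- exact: avoids_infix (infix_drop _ _) wF.
rewrite (bigD1 i) //= big1 ?addr0 ?suffix_allowed_word ?iw ?eqxx // => j ji.
by rewrite suffix_allowed_word -iw (inj_eq allowed_word_inj) (negbTE ji) mul0r.
Qed.

(** Forbidden words have length at most [p], so a word of length at least [p]
    avoids them as soon as it does so after removing its last letter and its last
    block of length [p] does so too. *)
Lemma avoids_rcons_last_block w c : (p.-1 <= size w)%N ->
  avoids F (rcons w c) = avoids F w && avoids F (rcons (last_block w) c).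
Proof.
move=> pw; case: (boolP (avoids F w)) => wF; rewrite avoids_rcons ?(negbTE wF) //=.
have lF : avoids F (last_block w) by apply: avoids_infix (infix_drop _ _) wF.
rewrite avoids_rcons lF wF /=; congr (~~ _); apply: eq_in_has => a aF.
have sl : size (last_block w) = p.-1 by rewrite size_drop subKn.
have -> : rcons w c = take (size w - p.-1) w ++ rcons (last_block w) c.
  by rewrite -rcons_cat cat_take_drop.
apply/idP/idP; last exact: suffix_catr.
rewrite !suffixE size_cat size_rcons sl prednK ?(ltnW maxlen_gt1) //.
rewrite -addnBA ?leq_maxlen // drop_cat ltnNge leq_addr /= addKn.
by [].
Qed.

Lemma state_countsS n : (p.-1 <= n)%N ->
  state_counts n.+1 = state_counts n *m A.
Proof.
move=> pn; apply/rowP => j; rewrite !mxE.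
set v := allowed_word j.
pose Q u : K := (`[< behead u = take p.-2 v /\ allowed F (u ++ drop p.-2 v) >])%:R.
rewrite (eq_bigr (fun i => state_counts n 0 i * Q (allowed_word i))); last first.
  by move=> i _; rewrite [A i j]mxE.
rewrite sum_state_counts //.
have := size_allowed_word j; rewrite -/v.
have p1 : p.-1 = p.-2.+1 by case: (p) maxlen_gt1 => [|[]].
(* The new letter is the last letter [d] of the new state. *)
case/lastP: v @Q => [|v d] Q; first by rewrite p1.
rewrite size_rcons p1 => -[sv].
rewrite -addn1 (@sum_tuple_suffix _ n [:: d]
    (fun w => avoids F w && suffix (rcons v d) w)) => [|w]; last first.
  rewrite eqb0 negbK => /andP[_]; apply: suffix_trans.
  by rewrite -cats1 suffix_suffix.
rewrite natr_sum; apply: eq_bigr => w _.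
rewrite cats1 suffix_rcons eqxx /= avoids_rcons_last_block ?size_tuple //.
rewrite /Q -[RHS]natrM mulnb; congr (_%:R); rewrite -andbA; congr (nat_of_bool (_ && _)).
rewrite -(cats1 v d) -sv take_size_cat // drop_size_cat // cats1.
have -> : suffix v w = (behead (last_block w) == v).
  rewrite /last_block suffixE sv -drop1 drop_drop add1n p1 subnSK //.
  by rewrite size_tuple -p1.
apply/andP/asboolP => [[h /eqP ->]|[-> h]]; first by split=> //; apply/allowedE.
by split=> //; apply/allowedE.
Qed.

(** A word of length [p - 1] is its own state, whence the initial row of ones. *)
Lemma state_countsD m : state_counts (p.-1 + m) = const_mx 1 *m A ^+ m.
Proof.
elim: m => [|m IH]; last first.
  by rewrite addnS state_countsS ?leq_addr // IH exprSr -mulmxA.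
rewrite addn0 expr0 mulmx1; apply/rowP => i; rewrite !mxE.
rewrite (bigD1 (enum_val i)) //= suffix_refl allowed_word_avoids big1 // => w wi.
rewrite suffix_allowed_word /last_block size_tuple subnn drop0.
case: eqP => [e|]; last by rewrite andbF.
by case/eqP: wi; apply: val_inj.
Qed.

Lemma num_avoiding_transfer m : (num_avoiding F (p.-1 + m))%:R =
  (const_mx 1 *m A ^+ m *m const_mx 1 : 'M_1) 0 0.
Proof.
rewrite -state_countsD mxE natr_sum.
under eq_bigr => i _ do rewrite -[(avoids F _)%:R]mulr1.
rewrite -(sum_state_counts (fun=> 1)) ?leq_addr //.
by apply: eq_bigr => i _; rewrite mxE mxE.
Qed.

(** A first hit of [a] is an avoiding word followed by the last letter of [a];
    whether it occurs depends only on the last block of that avoiding word,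
    which is long enough to contain the rest of [a]. *)
Lemma num_first_hit_transfer a : a \in F ->
  exists b : 'cV[K]_#|allowed_words F p.-1|, forall m : nat,
    (num_first_hit F a (p + m))%:R = (const_mx 1 *m A ^+ m *m b : 'M_1) 0 0.
Proof.
move=> aF; have := leq_maxlen aF; have := forbidden_size hF aF.
case/lastP: a aF => [//|a c] aF _; rewrite size_rcons => ap.
exists (\col_i (suffix a (allowed_word i))%:R) => m.
rewrite -state_countsD mxE -[in LHS](ltn_predK maxlen_gt1) addSn -addn1.
rewrite /num_first_hit (@sum_tuple_suffix _ _ [:: c]
    (fun w => first_hit F (rcons a c) w)) => [|w]; last first.
  rewrite eqb0 negbK => /andP[+ _]; apply: suffix_trans.
  by rewrite -cats1 suffix_suffix.
transitivity (\sum_i state_counts (p.-1 + m) 0 i * (suffix a (allowed_word i))%:R : K).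
  rewrite (sum_state_counts (fun u => (suffix a u)%:R)) ?leq_addr // natr_sum.
  apply: eq_bigr => w _; rewrite cats1 first_hit_rcons suffix_rcons eqxx /=.
  rewrite -natrM mulnb andbC; congr (_ && _)%:R; rewrite !suffixE.
  have ap' : (size a <= p.-1)%N by rewrite -ltnS (ltn_predK maxlen_gt1).
  rewrite /last_block drop_drop size_drop size_tuple subKn ?leq_addr //.
  congr (drop _ _ == _).
  by rewrite [RHS]addnC addnBA // subnK ?leq_addr.
by apply: eq_bigr => i _; congr (_ * _); rewrite mxE.
Qed.

End Transfer.

(** * Generating functions of linearly recurrent sequences *)

Section Recurrence.

Variable K : comNzRingType.
Implicit Types (P : {poly K}) (h : nat -> K).

Definition recurrence P h :=
  forall n, \sum_(i < size P) P`_i * h (n + i)%N = 0.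

(** The numerator over [P] of the series [\sum_n h n / X^(n+1)], when [h]
    satisfies the recurrence with characteristic polynomial [P]: it is the
    polynomial part of the product of [P] with that series. *)
Definition gf_num P h : {poly K} :=
  \sum_(i < size P) P`_i *: \sum_(k < i) h k *: 'X^(i.-1 - k).

Lemma eq_gf_num P h1 h2 : h1 =1 h2 -> gf_num P h1 = gf_num P h2.
Proof.
move=> e; apply: eq_bigr => i _; congr (_ *: _).
by apply: eq_bigr => k _; rewrite e.
Qed.

Lemma gf_num_sum P (I : Type) (r : seq I) (c : I -> K) (h : I -> nat -> K) :
  gf_num P (fun n => \sum_(j <- r) c j * h j n) =
  \sum_(j <- r) c j *: gf_num P (h j).
Proof.
rewrite /gf_num; under [RHS]eq_bigr => j _ do rewrite scaler_sumr.
rewrite exchange_big; apply: eq_bigr => i _ /=.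
under [RHS]eq_bigr => j _ do rewrite scalerA mulrC -scalerA.
rewrite -scaler_sumr; congr (_ *: _).
under [RHS]eq_bigr => j _ do rewrite scaler_sumr.
rewrite exchange_big; apply: eq_bigr => k _ /=.
by rewrite scaler_suml; apply: eq_bigr => j _; rewrite scalerA.
Qed.

Lemma gf_numZ P c h : gf_num P (fun n => c * h n) = c *: gf_num P h.
Proof.
have := gf_num_sum P [:: tt] (fun=> c) (fun=> h).
by rewrite big_seq1 => <-; apply: eq_gf_num => n; rewrite big_seq1.
Qed.

Lemma gf_numD P h1 h2 :
  gf_num P (fun n => h1 n + h2 n) = gf_num P h1 + gf_num P h2.
Proof.
have := gf_num_sum P [:: true; false] (fun=> 1) (fun b => if b then h1 else h2).
rewrite !big_cons !big_nil !scale1r !addr0 => <-.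
by apply: eq_gf_num => n; rewrite !big_cons !big_nil !mul1r !addr0.
Qed.

Lemma recurrence_shift P h k :
  recurrence P h -> recurrence P (fun n => h (n + k)%N).
Proof.
move=> Ph n; rewrite -[RHS](Ph (n + k)%N).
by apply: eq_bigr => i _; rewrite addnAC.
Qed.

(** The recurrence at [0] kills the terms [P`_i * h i] that appear when each inner
    sum is shifted. *)
Lemma gf_numS P h : recurrence P h ->
  gf_num P (fun n => h n.+1) = 'X * gf_num P h - h 0%N *: P.
Proof.
move=> Ph.
have one i : \sum_(k < i) h k.+1 *: 'X^(i.-1 - k) =
    'X * (\sum_(k < i) h k *: 'X^(i.-1 - k)) + (h i)%:P - h 0%N *: 'X^i :> {poly K}.
  apply/esym/eqP; rewrite subr_eq; apply/eqP.
  transitivity (\sum_(k < i.+1) h k *: 'X^(i - k) : {poly K}).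
    rewrite big_ord_recr /= subnn expr0 alg_polyC mulr_sumr; congr (_ + _).
    apply: eq_bigr => k _; rewrite -scalerAr -exprS; congr (_ *: 'X^_).
    by case: i k => [[]//|i] k; rewrite subSn // -ltnS.
  rewrite big_ord_recl subn0 addrC; congr (_ + _).
  by apply: eq_bigr => k _; rewrite lift0; congr (_ *: 'X^_); case: i k => [[]|i] k.
rewrite /gf_num; under eq_bigr => i _ do rewrite one scalerBr scalerDr.
rewrite !big_split /= sumrN; congr (_ + _); last first.
  congr (- _); rewrite -[in RHS](coefK P) poly_def scaler_sumr.
  by apply: eq_bigr => i _; rewrite !scalerA mulrC.
rewrite mulr_sumr -[RHS]addr0; congr (_ + _).
  by apply: eq_bigr => i _; rewrite scalerAr.
rewrite -[RHS]polyC0; apply: etrans (congr1 (@polyC K) (Ph 0%N)); rewrite rmorph_sum /=.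
apply: eq_bigr => i _.
by rewrite add0n rmorphM /= mul_polyC.
Qed.

Lemma gf_num_shift P h k : recurrence P h ->
  gf_num P (fun n => h (n + k)%N) =
  'X^k * gf_num P h - (\sum_(m < k) h m *: 'X^(k.-1 - m)) * P.
Proof.
move=> Ph; elim: k => [|k IH].
  rewrite big_ord0 mul0r subr0 expr0 mul1r.
  by apply: eq_gf_num => n; rewrite addn0.
have /gf_numS := @recurrence_shift P h k Ph.
rewrite (@eq_gf_num P _ (fun n => h (n + k.+1)%N)) => [->|n]; last by rewrite addnS.
rewrite IH mulrBr mulrA -exprS -addrA; congr (_ + _).
rewrite -opprD; congr (- _).
rewrite big_ord_recr /= subnn expr0 mulrDl add0n alg_polyC mul_polyC; congr (_ + _).
rewrite mulrA mulr_sumr; congr (_ * _); apply: eq_bigr => m _.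
rewrite -scalerAr -exprS; congr (_ *: 'X^_).
by case: k m {IH} => [[]//|k] m; rewrite subSn // -ltnS.
Qed.

(** A transfer matrix gives a recurrence by the Cayley-Hamilton theorem; the
    factor ['X^k] discards the [k] terms before the matrix takes over. *)
Lemma recurrence_mx N (A : 'M[K]_N) (a : 'rV[K]_N) (b : 'cV[K]_N) k h :
    (forall m, h (k + m)%N = (a *m A ^+ m *m b) 0 0) ->
  recurrence ('X^k * char_poly A) h.
Proof.
move=> hA.
have CH : \sum_(i < size (char_poly A)) (char_poly A)`_i *: A ^+ i = 0.
  case: N A {a b hA} => [|N] A; first by apply/matrixP => -[].
  apply: etrans _ (Cayley_Hamilton A).
  rewrite -[in RHS](coefK (char_poly A)) poly_def rmorph_sum.
  by apply: eq_bigr => i _; rewrite /= linearZ /= rmorphXn /= horner_mx_X.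
move=> n; rewrite mulrC size_monicM ?char_poly_monic ?monic_neq0 ?monicXn //;
  last first.
rewrite size_polyXn addnS /= addnC big_split_ord /= big1 ?add0r => [|i _]; last first.
  by rewrite coefMXn ltn_ord mul0r.
transitivity ((a *m A ^+ n *m
    (\sum_(i < size (char_poly A)) (char_poly A)`_i *: A ^+ i) *m b) 0 0);
  last first.
  by rewrite CH mulmx0 mul0mx mxE.
rewrite mulmx_sumr mulmx_suml summxE; apply: eq_bigr => i _.
rewrite coefMXn ltnNge leq_addr /= addKn addnCA hA.
have -> : A ^+ (n + i) = A ^+ n *m A ^+ i by rewrite exprD.
by rewrite -scalemxAr -scalemxAl [in RHS]mxE !mulmxA.
Qed.

End Recurrence.

Lemma map_gf_num (K L : fieldType) (f : {rmorphism K -> L}) (P : {poly K}) h :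
  gf_num (map_poly f P) (fun n => f (h n)) = map_poly f (gf_num P h).
Proof.
rewrite /gf_num rmorph_sum /= size_map_poly; apply: eq_bigr => i _.
rewrite coef_map /= linearZ /= rmorph_sum; congr (_ *: _).
by apply: eq_bigr => k _; rewrite /= linearZ /= map_polyXn.
Qed.

(** * The generating function of the avoiding words *)

Section Correlation.

Variables (K : fieldType) (q s : nat) (F : s.-tuple (seq 'I_q)).
Hypothesis hF : minimal_collection F.

Local Notation A := (adjacency_mx K F).

Lemma corr_polyE (x y : seq 'I_q) : corr_poly K x y =
  \poly_(k < size x) (corr_coef x y (size x - k.+1))%:R.
Proof.
rewrite poly_def /corr_poly (reindex_inj rev_ord_inj) /=.
apply: eq_bigr => k _; congr (_ *: 'X^_).
by case: (size x) k => [[]//|n] k; rewrite /= subSS subKn // -ltnS.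
Qed.

(** In column [j] of the correlation matrix the diagonal entry has the largest
    degree, since no forbidden word is a prefix of another one. *)
Lemma size_corr_mx i j :
  (size (corr_mx K F i j) <= (size (tnth F j)).-1 + (i == j))%N.
Proof.
have aF := mem_tnth j F; have a2 := forbidden_size hF aF.
rewrite mxE corr_polyE; case: eqP => [_|/eqP ij].
  by rewrite addn1 prednK ?size_poly // ltnW.
rewrite addn0; apply/leq_sizeP => k; rewrite leq_eqVlt => /predU1P[<-|]; last first.
  by rewrite (ltn_predK a2) coef_poly ltnNge => ->.
rewrite coef_poly (ltn_predK a2) leqnn subnn /corr_coef subn0 drop0.
case: eqP => // e; case/eqP: ij; apply/esym.
have uF : uniq F by case: hF.
apply: (tuple_uniqP _ uF).
move: e; case: leqP => le; rewrite take_size => e.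
  by apply: (forbidden_infix_eq hF); rewrite ?mem_tnth // [X in infix X]e infix_take.
by apply/esym; apply: (forbidden_infix_eq hF); rewrite ?mem_tnth // -e infix_take.
Qed.

Lemma size_corr_mx_diag j : size (corr_mx K F j j) = size (tnth F j).
Proof.
have a2 := forbidden_size hF (mem_tnth j F).
rewrite mxE corr_polyE size_poly_eq // (ltn_predK a2) subnn /corr_coef.
by rewrite drop0 eqxx oner_eq0.
Qed.

(** In a linear relation between the rows, a coefficient [v 0 j] of maximal degree
    contributes through the diagonal a term that nothing else in column [j] can
    cancel. *)
Lemma det_corr_mx_neq0 : \det (corr_mx K F) != 0.
Proof.
apply/negP => /det0P[v v0 vM].
have [j0 vj0] : exists j, v 0 j != 0.
  apply/existsP; apply: contraNT v0; rewrite negb_exists => /forallP h.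
  by apply/eqP/rowP => j; rewrite [RHS]mxE; apply/eqP/negPn.
pose j := [arg max_(i > j0) size (v 0%R i)]%N.
have jmax i : (size (v 0%R i) <= size (v 0%R j))%N by rewrite /j; case: arg_maxnP => // k _; apply.
have sj : (0 < size (v 0%R j))%N by apply: leq_trans (jmax j0); rewrite size_poly_gt0.
have a2 := forbidden_size hF (mem_tnth j F).
have := congr1 (fun w : 'rV_s => w 0 j) vM; rewrite !mxE (bigD1 j) //= => /eqP.
rewrite addr_eq0 => /eqP /(congr1 (fun r : {poly K} => size r)) /eqP.
apply/negP; rewrite neq_ltn; apply/orP; right.
rewrite size_polyN size_mul -?size_poly_gt0 ?size_corr_mx_diag ?(ltnW a2) //.
apply: (@leq_ltn_trans (size (v 0%R j) + (size (tnth F j)).-1).-1); last first.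
  by case: (size (tnth F j)) a2 => [//|k] _; rewrite addnS ltn_predL addn_gt0 sj.
apply: leq_trans (size_sum _ _ _) _; apply/bigmax_leqP => i ij.
apply: leq_trans (size_polyMleq _ _) _; rewrite -!subn1 leq_sub2r // leq_add //.
by apply: leq_trans (size_corr_mx _ _) _; rewrite (negbTE ij) addn0 subn1.
Qed.

(** The transfer matrix describes [num_avoiding] from length [p - 1] on and
    [num_first_hit] from length [p] on; the power of ['X] covers both. *)
Definition count_char_poly : {poly K} := 'X^(maxlen F) * char_poly A.
Definition avoiding_num : {poly K} :=
  gf_num count_char_poly (fun n => (num_avoiding F n)%:R).
Definition first_hit_num j : {poly K} :=
  gf_num count_char_poly (fun n => (num_first_hit F (tnth F j) n)%:R).

Lemma recurrence_num_avoiding :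
  recurrence count_char_poly (fun n => (num_avoiding F n)%:R).
Proof.
apply: (@recurrence_mx _ _ _ (const_mx 1 *m A) (const_mx 1)) => m.
have -> : (maxlen F + m = (maxlen F).-1 + m.+1)%N.
  by rewrite addnS -addSn (ltn_predK (maxlen_gt1 hF)).
by rewrite num_avoiding_transfer // exprS -!mulmxA.
Qed.

Lemma recurrence_num_first_hit j :
  recurrence count_char_poly (fun n => (num_first_hit F (tnth F j) n)%:R).
Proof.
have [b hb] := num_first_hit_transfer K hF (mem_tnth j F).
exact: recurrence_mx hb.
Qed.

Lemma num_avoidingS_gf :
  ('X - q%:R%:P) * avoiding_num + 'X * \sum_j first_hit_num j = count_char_poly.
Proof.
have : gf_num count_char_poly (fun n => q%:R * (num_avoiding F n)%:R) =
    gf_num count_char_poly (fun n => (num_avoiding F n.+1)%:R +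
      \sum_j 1 * (num_first_hit F (tnth F j) n.+1)%:R).
  apply: eq_gf_num => n; rewrite -natrM num_avoidingS // natrD natr_sum big_tuple.
  by congr (_ + _); apply: eq_bigr => j _; rewrite mul1r.
have /= UE := gf_numS recurrence_num_avoiding.
have GE j : gf_num count_char_poly (fun n => (num_first_hit F (tnth F j) n.+1)%:R) =
    'X * first_hit_num j.
  have /= -> := gf_numS (recurrence_num_first_hit j).
  rewrite num_first_hit_small ?scale0r ?subr0 //.
  by apply: ltnW (forbidden_size hF (mem_tnth j F)).
rewrite gf_numZ gf_numD gf_num_sum UE.
rewrite [X in _ = _ + X -> _](eq_bigr (fun j => 'X * first_hit_num j)) => [|j _]; last first.
  by rewrite scale1r GE.
rewrite -mulr_sumr num_avoiding0 // scale1r -/avoiding_num.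
move=> e; rewrite mulrBl mul_polyC e.
by rewrite opprD addrA subrK opprB addrC subrK.
Qed.

(** The shifts in [num_avoiding_corr] are plain multiplications here: they are at
    most the length of the forbidden word, below which [num_first_hit] is [0]. *)
Lemma num_avoiding_corr_gf i :
  avoiding_num = \sum_j corr_mx K F i j * ('X * first_hit_num j).
Proof.
pose h j l n : K := (num_first_hit F (tnth F j) (n + (size (tnth F j) - l)))%:R.
transitivity (gf_num count_char_poly (fun n => \sum_j 1 * (\sum_(l < size (tnth F j))
    (corr_coef (tnth F j) (tnth F i) l)%:R * h j l n))).
  apply: eq_gf_num => n; rewrite (num_avoiding_corr hF _ (mem_tnth i F)) natr_sum big_tuple.
  apply: eq_bigr => j _; rewrite mul1r natr_sum.
  by apply: eq_bigr => l _; rewrite natrM.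
rewrite gf_num_sum; apply: eq_bigr => j _; rewrite scale1r gf_num_sum.
rewrite mxE /corr_poly mulr_suml; apply: eq_bigr => l _.
rewrite -scalerAl mulrA -exprSr; congr (_ *: _).
have /= -> := gf_num_shift (size (tnth F j) - l) (recurrence_num_first_hit j).
rewrite big1 ?mul0r ?subr0 => [|m _]; last first.
  by rewrite num_first_hit_small ?scale0r // (leq_trans (ltn_ord m)) ?leq_subr.
congr ('X^_ * _); case: (size (tnth F j)) l => [[]//|k] l /=.
by rewrite subSn // -ltnS.
Qed.

(** Write [M] for the correlation matrix, [g] for the column of the
    ['X * first_hit_num j] and [U] for [avoiding_num]. Then [M g] is the constant
    column [U], so the entries of [g] add up to [U] times the sum of the entries
    of the inverse of [M]. *)
Lemma forbidden_ratfun_avoiding :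
  ratfun avoiding_num * forbidden_ratfun K F = ratfun count_char_poly.
Proof.
pose M := map_mx (@ratfun K) (corr_mx K F).
have Munit : M \in unitmx.
  by rewrite unitmxE unitfE det_map_mx tofrac_eq0 det_corr_mx_neq0.
pose g : 'cV_s := \col_j ratfun ('X * first_hit_num j).
have Mg : M *m g = const_mx (ratfun avoiding_num).
  apply/colP => i; rewrite !mxE (num_avoiding_corr_gf i) /ratfun rmorph_sum.
  by apply: eq_bigr => j _; rewrite !mxE -rmorphM.
have gE : g = ratfun avoiding_num *: (invmx M *m const_mx 1).
  rewrite -[LHS](mulKmx Munit) Mg scalemxAr; congr (_ *m _).
  by apply/colP => i; rewrite !mxE mulr1.
have sumg : ratfun ('X * \sum_j first_hit_num j) = ratfun avoiding_num * corr_r K F.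
  rewrite mulr_sumr /ratfun rmorph_sum /corr_r mulr_sumr; apply: eq_bigr => i _.
  have := congr1 (fun w : 'cV_s => w i 0) gE; rewrite !mxE => e; apply: etrans e _; congr (_ * _).
  by apply: eq_bigr => j _; rewrite mxE mulr1.
rewrite /forbidden_ratfun mulrDr -sumg mulrC /ratfun -rmorphM -rmorphD.
by rewrite num_avoidingS_gf.
Qed.

End Correlation.

Local Open Scope complex_scope.

(** * Spectral bounds for nonnegative matrices *)

Lemma prod_mx_sub_roots_eq0 (K : comNzRingType) N (A : 'M[K]_N) (rs : seq K) :
  char_poly A = \prod_(z <- rs) ('X - z%:P) -> \prod_(z <- rs) (A - z%:M) = 0.
Proof.
case: N A => [|N] A Ars; first by apply/matrixP => -[].
apply: etrans _ (Cayley_Hamilton A); rewrite Ars rmorph_prod.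
by apply: eq_bigr => z _; rewrite rmorphB /= horner_mx_X horner_mx_C.
Qed.

(** Removing one factor at a time, the entries [x_m] of [B *m A ^+ m] satisfy
    [x_(m+1) = z x_m + O(rho^m)], with [z] of modulus less than [rho]. *)
Lemma mx_exp_bound_annihilated (K : numFieldType) N (A : 'M[K]_N) (th rho : K)
    (rs : seq K) (B : 'M[K]_N) :
    0 <= th -> th < rho -> (forall z, z \in rs -> `|z| <= th) ->
    B *m \prod_(z <- rs) (A - z%:M) = 0 ->
  exists2 c, 0 <= c & forall m i j, `|(B *m A ^+ m) i j| <= c * rho ^+ m.
Proof.
move=> th0 thr; have rho0 : 0 < rho by apply: le_lt_trans thr.
elim: rs B => [|z rs IH] B zth.
  rewrite big_nil => /= B0; have {B0} B0 : B = 0 by rewrite -[LHS]mulmx1.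
  exists 0 => // m i j; by rewrite B0 mul0mx mxE normr0 mul0r.
rewrite big_cons => hB.
have [||c c0 hc] := IH (B *m (A - z%:M)).
- by move=> x xrs; apply: zth; rewrite inE xrs orbT.
- by rewrite -mulmxA.
have hz : `|z| <= th by apply: zth; rewrite inE eqxx.
(* The sum bounds the initial term, and [c / (rho - th)] is the constant that the
   recurrence reproduces: [th * d + c <= rho * d]. *)
pose d := \sum_i \sum_j `|B i j| + c / (rho - th).
have cd0 : 0 <= c / (rho - th) by rewrite divr_ge0 // subr_ge0 ltW.
have d0 : 0 <= d by rewrite addr_ge0 // !sumr_ge0 // => i _; rewrite sumr_ge0.
exists d => //; elim=> [|m IHm] i j.
  rewrite expr0 mulmx1 mulr1 /d (bigD1 i) //= (bigD1 j) //= -!addrA lerDl.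
  rewrite addr_ge0 ?sumr_ge0 // addr_ge0 // sumr_ge0 // => k _.
  by rewrite sumr_ge0.
have -> : B *m A ^+ m.+1 = z *: (B *m A ^+ m) + B *m (A - z%:M) *m A ^+ m.
  rewrite exprS mulmxBr mulmxBl mul_mx_scalar -scalemxAl addrC subrK.
  by rewrite -mulmxA.
rewrite mxE; apply: le_trans (ler_normD _ _) _.
rewrite mxE normrM; apply: le_trans (lerD (ler_pM _ _ hz (IHm i j)) (hc m i j)) _ => //.
rewrite mulrA -mulrDl exprS mulrA; apply: ler_wpM2r; first by rewrite exprn_ge0 // ltW.
rewrite -lerBrDl [d * rho]mulrC -mulrBl mulrC /d mulrDl divfK; last by rewrite subr_eq0 gt_eqF.
rewrite lerDr mulr_ge0 // ?subr_ge0 ?(ltW thr) // !sumr_ge0 // => k _.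
by rewrite sumr_ge0.
Qed.

Lemma expr_unbounded (R : archiRealFieldType) (x b : R) :
  1 < x -> exists m, b < x ^+ m.
Proof.
move=> x1; have e0 : 0 < x - 1 by rewrite subr_gt0.
have bernoulli (e : R) m : 0 <= e -> 1 + e *+ m <= (1 + e) ^+ m.
  move=> e_ge0; elim: m => [|m IH]; first by rewrite mulr0n addr0.
  rewrite exprS; apply: le_trans (ler_wpM2l (addr_ge0 ler01 e_ge0) IH).
  rewrite mulrDl mul1r mulrDr mulr1 mulrSr -!addrA !lerD2l lerDl.
  by rewrite mulr_ge0 ?mulrn_wge0.
pose m := Num.bound `|b / (x - 1)|; exists m.
have := bernoulli _ m (ltW e0); rewrite [1 + (x - 1)]addrC subrK.
apply: lt_le_trans.
have : b / (x - 1) < m%:R by apply: le_lt_trans (ler_norm _) (archi_boundP (normr_ge0 _)).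
rewrite ltr_pdivrMr // mulrC mulr_natr => /lt_trans; apply.
by rewrite ltrDr ltr01.
Qed.

Section Nonnegative.

Variable R : realType.

Lemma norm_Re (z : R[i]) : (complex.Re `|z|)%:C = `|z|.
Proof. by rewrite normc_def. Qed.

Lemma norm_real (x : R) : `|x%:C| = `|x|%:C.
Proof. by rewrite normc_def /= expr0n /= addr0 sqrtr_sqr. Qed.

Definition spectral_bound N (A : 'M[R]_N) (th : R) :=
  0 <= th /\
  forall z, root (char_poly (map_mx (real_complex R) A)) z -> `|z| <= th%:C.

Lemma spectral_bound_trmx N (A : 'M[R]_N) th :
  spectral_bound A th -> spectral_bound A^T th.
Proof.
case=> th0 h; split; first exact: th0.
move=> z; rewrite -map_trmx => rz; apply: h; move: rz.
rewrite /char_poly -det_tr; congr (root (\det _) z).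
by apply/matrixP => i j; rewrite !mxE eq_sym.
Qed.

Lemma mx_exp_bound N (A : 'M[R]_N) th rho : spectral_bound A th -> th < rho ->
  exists2 c, 0 <= c & forall m i j, (A ^+ m) i j <= c * rho ^+ m.
Proof.
move=> [th0 h] thr; pose AC := map_mx (real_complex R) A.
have [rs rsE] := closed_field_poly_normal (char_poly AC).
rewrite (monicP (char_poly_monic _)) scale1r in rsE.
have [||z zrs||c c0 hc] :=
  @mx_exp_bound_annihilated _ N AC th%:C rho%:C rs 1%:M.
- by rewrite lecR.
- by rewrite ltcR.
- by apply: h; rewrite rsE root_prod_XsubC.
- by rewrite mul1mx prod_mx_sub_roots_eq0.
exists (complex.Re `|c|) => [|m i j].
  by rewrite -lecR -(ger0_norm c0) norm_Re rmorph0.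
have := hc m i j; rewrite mul1mx.
have -> : AC ^+ m = map_mx (real_complex R) (A ^+ m).
  elim: m => [|m IH]; first by rewrite !expr0 map_mx1.
  by rewrite !exprS IH map_mxM.
rewrite mxE -{1}(ger0_norm c0) -norm_Re -rmorphXn -rmorphM.
move=> le; rewrite -lecR; apply: le_trans le.
by rewrite norm_real lecR ler_norm.
Qed.

Definition mx_ge0 m n (A : 'M[R]_(m, n)) := forall i j, 0 <= A i j.

Lemma mulmx_ge0 m n k (A : 'M[R]_(m, n)) (B : 'M[R]_(n, k)) :
  mx_ge0 A -> mx_ge0 B -> mx_ge0 (A *m B).
Proof. by move=> A0 B0 i j; rewrite mxE sumr_ge0 // => l _; rewrite mulr_ge0. Qed.

Lemma mx_exp_ge0 N (A : 'M[R]_N) m : mx_ge0 A -> mx_ge0 (A ^+ m).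
Proof.
move=> A0; elim: m => [|m IH]; first by move=> i j; rewrite expr0 mxE ler0n.
by rewrite exprS; apply: mulmx_ge0.
Qed.

(** A nonnegative vector which [A] expands by a factor [t] exceeding every
    eigenvalue vanishes: iterating, [A ^+ m] would grow like [t ^+ m]. *)
Lemma expanding_col_eq0 N (A : 'M[R]_N) th t (w : 'cV[R]_N) :
    mx_ge0 A -> spectral_bound A th -> th < t -> mx_ge0 w ->
    (forall i, t * w i 0 <= (A *m w) i 0) ->
  w = 0.
Proof.
move=> A0 hA tht w0 hw; apply/colP => i; rewrite [RHS]mxE; apply/eqP/negPn/negP => wi.
have wi0 : 0 < w i 0 by rewrite lt_neqAle eq_sym wi w0.
have th0 : 0 <= th by case: hA.
have t0 : 0 < t by apply: le_lt_trans tht.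
pose rho := (th + t) / 2.
have [thr rt] : th < rho /\ rho < t by have [] := midf_lt tht.
have r0 : 0 < rho by apply: le_lt_trans thr.
have [c c0 hc] := mx_exp_bound hA thr.
have grow m j : t ^+ m * w j 0 <= (A ^+ m *m w) j 0.
  elim: m j => [|m IH] j; first by rewrite !expr0 mul1r mul1mx.
  rewrite exprS -mulrA; apply: (@le_trans _ _ (\sum_k A j k * (t ^+ m * w k 0))).
    rewrite mulrCA; have := ler_wpM2l (exprn_ge0 m (ltW t0)) (hw j).
    move=> /le_trans; apply; rewrite mxE mulr_sumr le_eqVlt; apply/orP; left.
    by apply/eqP/eq_bigr => k _; rewrite mulrCA.
  rewrite exprS -mulmxA mxE; apply: ler_sum => k _.
  by apply: ler_wpM2l.
have x1 : 1 < t / rho by rewrite ltr_pdivlMr // mul1r.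
have [m] := expr_unbounded (c * (\sum_k w k 0) / w i 0) x1.
apply/negP; rewrite -leNgt ler_pdivlMr // expr_div_n mulrAC ler_pdivrMr ?exprn_gt0 //.
apply: le_trans (grow m i) _; rewrite mxE mulrAC mulr_sumr; apply: ler_sum => k _.
by apply: ler_wpM2r.
Qed.

Lemma expanding_row_eq0 N (A : 'M[R]_N) th t (y : 'rV[R]_N) :
    mx_ge0 A -> spectral_bound A th -> th < t -> mx_ge0 y ->
    (forall j, t * y 0 j <= (y *m A) 0 j) ->
  y = 0.
Proof.
move=> A0 hA tht y0 hy; apply: trmx_inj; rewrite trmx0.
have At0 : mx_ge0 A^T by move=> i j; rewrite mxE.
apply: (expanding_col_eq0 At0 (spectral_bound_trmx hA) tht).
  by move=> i j; rewrite mxE.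
by move=> i; rewrite -trmx_mul mxE [leRHS]mxE.
Qed.

(** The moduli of the coordinates of an eigenvector form a nonnegative vector
    that [A] expands, by the triangle inequality. *)
Lemma subinvariant_row N (A : 'M[R]_N) th (z : R[i]) :
    mx_ge0 A -> root (char_poly (map_mx (real_complex R) A)) z ->
    `|z| = th%:C ->
  exists y : 'rV[R]_N,
    [/\ y != 0, mx_ge0 y & forall j, th * y 0 j <= (y *m A) 0 j].
Proof.
move=> A0; rewrite -eigenvalue_root_char => /eigenvalueP[v vA v0] zth.
exists (\row_j complex.Re `|v 0 j|); split.
- apply: contraNneq v0 => y0; apply/eqP/rowP => j; rewrite [RHS]mxE.
  have := congr1 (fun y : 'rV_N => y 0 j) y0; rewrite !mxE => e.
  by apply/eqP; rewrite -normr_eq0 -norm_Re; rewrite e eqxx.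
- by move=> i j; rewrite mxE -lecR norm_Re rmorph0.
move=> j; rewrite -lecR rmorphM /= mxE norm_Re -zth -normrM.
have := congr1 (fun y : 'rV_N => y 0 j) vA; rewrite !mxE => <-.
rewrite rmorph_sum; apply: le_trans (ler_norm_sum _ _ _) _.
apply: ler_sum => k _; rewrite !mxE rmorphM /= norm_Re normrM.
by rewrite norm_real (ger0_norm (A0 k j)). 
Qed.

Lemma mulmx_pos_row N (B : 'M[R]_N) (x : 'rV[R]_N) :
    (forall i j, 0 < B i j) -> mx_ge0 x -> x != 0 ->
  forall j, 0 < (x *m B) 0 j.
Proof.
move=> B0 x0 xn0 j; rewrite mxE lt_neqAle sumr_ge0 ?andbT => [|k _]; last first.
  by rewrite mulr_ge0 // ltW.
rewrite eq_sym; apply: contraNneq xn0 => /psumr_eq0P h.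
apply/eqP/rowP => k; rewrite [RHS]mxE; apply/eqP.
have /eqP := h (fun l _ => mulr_ge0 (x0 0 l) (ltW (B0 l j))) k isT.
by rewrite mulf_eq0 (gt_eqF (B0 k j)) orbF => /eqP ->.
Qed.

(** If [y] is expanded by [th] but is not an eigenvector, then smoothing it with
    a positive matrix [B] commuting with [A] makes the expansion strict, which
    contradicts the spectral bound. *)
Lemma positive_row N (A : 'M[R]_N) th (y : 'rV[R]_N) :
    mx_ge0 A -> spectral_bound A th -> irreducible_mx A ->
    y != 0 -> mx_ge0 y -> (forall j, th * y 0 j <= (y *m A) 0 j) ->
  exists2 x : 'rV[R]_N, forall j, 0 < x 0 j & x *m A = th *: x.
Proof.
move=> A0 hA irr yn0 y0 hy.
have [l hl] : exists l : 'I_N -> 'I_N -> nat, forall i j, 0 < (A ^+ l i j) i j.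
  have h i : exists f : 'I_N -> nat, forall j, 0 < (A ^+ f j) i j.
    apply: (@fin_all_exists _ (fun=> nat) (fun j m => 0 < (A ^+ m) i j)) => j.
    by have [m [_ Am]] := irr i j; exists m.
  exact: (fin_all_exists h).
pose B := \sum_i \sum_j A ^+ l i j.
have BA : B *m A = A *m B.
  rewrite mulmx_suml mulmx_sumr; apply: eq_bigr => i _.
  rewrite mulmx_suml mulmx_sumr; apply: eq_bigr => j _.
  by rewrite [LHS](esym (exprSr A _)) exprS.
have B0 i j : 0 < B i j.
  apply: lt_le_trans (hl i j) _; rewrite /B summxE (bigD1 i) //= summxE (bigD1 j) //=.
  rewrite -addrA lerDl addr_ge0 ?sumr_ge0 // => k _.
    exact: mx_exp_ge0.
  by rewrite summxE sumr_ge0 // => k' _; apply: mx_exp_ge0.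
pose x := y *m B; have x0 := mulmx_pos_row B0 y0 yn0.
exists x => //; apply/eqP; rewrite -subr_eq0; apply/negPn/negP.
pose z := y *m A - th *: y.
have zB : x *m A - th *: x = z *m B.
  by rewrite /x -mulmxA BA mulmxA scalemxAl -mulmxBl.
rewrite zB => zBn0.
have zn0 : z != 0 by apply: contraNneq zBn0 => ->; rewrite mul0mx.
have z0 : mx_ge0 z by move=> i j; rewrite !mxE ord1 subr_ge0; have := hy j; rewrite mxE.
have w0 := mulmx_pos_row B0 z0 zn0.
have [j0 yj0] : exists j, y 0 j != 0.
  apply/existsP; apply: contraNT yn0; rewrite negb_exists => /forallP h.
  by apply/eqP/rowP => j; rewrite [RHS]mxE; apply/eqP/negPn.
(* [S^-1] is at most each ratio [(z *m B) 0 j / x 0 j], so the expansion factor of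
   [x] is at least [th + S^-1]. *)
pose S := \sum_j x 0 j / (z *m B) 0 j.
have xwS j : x 0 j / (z *m B) 0 j <= S.
  by rewrite /S (bigD1 j) //= lerDl sumr_ge0 // => k _; rewrite divr_ge0 // ltW.
have S0 : 0 < S by apply: lt_le_trans (xwS j0); rewrite divr_gt0.
have xn : x = 0.
  apply: (expanding_row_eq0 (A := A) (th := th) (t := th + S^-1)) => //.
  - by rewrite ltrDl invr_gt0.
  - by move=> i j; rewrite ord1 ltW.
  move=> j; rewrite mulrDl.
  have -> : x *m A = th *: x + z *m B by rewrite -zB addrC subrK.
  rewrite [leRHS]mxE [(th *: x) _ _]mxE lerD2l ler_pdivrMl // mulrC.
  by have := xwS j; rewrite ler_pdivrMr // mulrC.
by have := x0 j0; rewrite -/x xn mxE ltxx.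
Qed.

(** The negative part of [v] is expanded by [t], hence zero. *)
Lemma resolvent_ge0 N (A : 'M[R]_N) th t (v : 'cV[R]_N) :
    mx_ge0 A -> spectral_bound A th -> th < t ->
    (forall i, t * v i 0 = 1 + (A *m v) i 0) ->
  mx_ge0 v.
Proof.
move=> A0 hA tht hv.
pose w : 'cV[R]_N := \col_i Num.max 0 (- v i 0).
have w0 : mx_ge0 w by move=> i j; rewrite mxE le_max lexx.
suff wz : w = 0.
  move=> i j; rewrite ord1; have := congr1 (fun u : 'cV_N => u i 0) wz.
  by rewrite !mxE => /eqP; rewrite eq_maxl oppr_le0.
have Aw i : 0 <= (A *m w) i 0 by apply: mulmx_ge0.
apply: (expanding_col_eq0 (A := A) (th := th) (t := t)) => // i.
rewrite [w i 0]mxE; case: (leP 0 (- v i 0)) => vi; last by rewrite mulr0.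
rewrite mulrN hv opprD; apply: (@le_trans _ _ (- (A *m v) i 0)).
  by rewrite gerDr oppr_le0.
rewrite !mxE -sumrN; apply: ler_sum => k _; rewrite -mulrN ler_wpM2l //.
by rewrite mxE le_max lexx orbT.
Qed.

(** Pairing [(t - A) v = 1] with [y] gives [y 1 = y (t - A) v <= (t - th) y v]. *)
Lemma resolvent_sum_lower N (A : 'M[R]_N) th t (v : 'cV[R]_N) (y : 'rV[R]_N) :
    mx_ge0 v -> th < t -> (forall i, t * v i 0 = 1 + (A *m v) i 0) ->
    y != 0 -> mx_ge0 y -> (forall j, th * y 0 j <= (y *m A) 0 j) ->
  1 <= (t - th) * \sum_i v i 0.
Proof.
move=> v0 tht hv yn0 y0 hy.
have y_gt0 : 0 < \sum_j y 0 j.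
  rewrite lt_neqAle sumr_ge0 // andbT eq_sym; apply: contraNneq yn0 => /psumr_eq0P h.
  by apply/eqP/rowP => j; rewrite [RHS]mxE h.
have yv : \sum_j y 0 j + (y *m A *m v) 0 0 = t * \sum_j y 0 j * v j 0.
  rewrite -mulmxA mxE -big_split mulr_sumr; apply: eq_bigr => j _.
  by rewrite /= mulrCA hv mulrDr mulr1.
have le1 : \sum_j y 0 j <= (t - th) * \sum_j y 0 j * v j 0.
  rewrite mulrBl -yv -addrA lerDl subr_ge0 mulr_sumr mxE; apply: ler_sum => j _.
  by rewrite mulrA ler_wpM2r.
rewrite -(ler_pM2l y_gt0) mulr1; apply: le_trans le1 _.
rewrite mulrCA ler_pM2l ?subr_gt0 // mulr_suml; apply: ler_sum => j _.
rewrite ler_wpM2l // (bigD1 j) //= lerDl sumr_ge0 //.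
Qed.

(** Here the pairing is the equality [x 1 = (t - th) x v], and [x] is bounded below
    because all its entries are positive. *)
Lemma resolvent_sum_upper N (A : 'M[R]_N) th t (v : 'cV[R]_N) (x : 'rV[R]_N) :
    mx_ge0 v -> th < t -> (forall i, t * v i 0 = 1 + (A *m v) i 0) ->
    (forall j, 0 < x 0 j) -> x *m A = th *: x ->
  (t - th) * \sum_i v i 0 <= (\sum_j x 0 j) * \sum_j (x 0 j)^-1.
Proof.
move=> v0 tht hv x0 hx.
have xv : \sum_j x 0 j + (x *m A *m v) 0 0 = t * \sum_j x 0 j * v j 0.
  rewrite -mulmxA mxE -big_split mulr_sumr; apply: eq_bigr => j _.
  by rewrite /= mulrCA hv mulrDr mulr1.
have -> : \sum_j x 0 j = (t - th) * \sum_j x 0 j * v j 0.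
  rewrite mulrBl -xv hx -scalemxAl mxE [(x *m v) 0 0]mxE.
  by rewrite addrK.
rewrite -mulrA ler_pM2l ?subr_gt0 // mulr_suml; apply: ler_sum => j _.
rewrite mulrAC -[leLHS]mul1r ler_wpM2r // -(mulfV (lt0r_neq0 (x0 j))).
rewrite ler_pM2l // (bigD1 j) //= lerDl sumr_ge0 // => k _.
by rewrite invr_ge0 ltW.
Qed.

(** The set of moduli of eigenvalues is finite, so its supremum is reached. *)
Lemma spectral_radiusP N (A : 'M[R]_N) : (0 < N)%N ->
  spectral_bound A (spectral_radius A) /\
  exists2 z, root (char_poly (map_mx (real_complex R) A)) z
           & `|z| = (spectral_radius A)%:C.
Proof.
move=> N0; set chi := char_poly _.
have [rs rsE] := closed_field_poly_normal chi.
rewrite (monicP (char_poly_monic _)) scale1r in rsE.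
have max_seq (s : seq R[i]) : s != [::] ->
    exists2 z, z \in s & forall x, x \in s -> complex.Re `|x| <= complex.Re `|z|.
  elim: s => // x s IH _; have [->|/IH[z zs hz]] := eqVneq s [::].
    by exists x; rewrite ?mem_head // => y; rewrite inE => /eqP ->.
  case: (leP (complex.Re `|x|) (complex.Re `|z|)) => xz.
    by exists z => [|y]; rewrite inE ?zs ?orbT // => /predU1P[->|/hz].
  exists x => [|y]; rewrite inE ?eqxx // => /predU1P[->|/hz] //.
  by move=> /le_trans; apply; apply: ltW.
have [|z zrs zmax] := max_seq rs.
  apply: contraTneq N0 => rs0; have := size_char_poly (map_mx (real_complex R) A).
  by rewrite -/chi rsE rs0 big_nil size_poly1 => -[<-].
have rootE x : root chi x = (x \in rs) by rewrite rsE root_prod_XsubC.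
have supE : spectral_radius A = complex.Re `|z|.
  apply/eqP; rewrite eq_le; apply/andP; split.
    apply: ge_sup => [|r [x]]; last first.
      rewrite eigenvalue_root_char rootE => xrs xr.
      by have := zmax x xrs; rewrite xr.
    exists (complex.Re `|z|); exists z; last by rewrite norm_Re.
    by rewrite eigenvalue_root_char rootE.
  apply: ub_le_sup.
    exists (complex.Re `|z|) => r [x]; rewrite eigenvalue_root_char rootE => xrs xr.
    by have := zmax x xrs; rewrite xr.
  exists z; last by rewrite norm_Re.
  by rewrite eigenvalue_root_char rootE.
rewrite supE; split; last by exists z; rewrite ?rootE // norm_Re.
split; first by rewrite -lecR norm_Re rmorph0.
by move=> x; rewrite -/chi rootE => /zmax xz; rewrite -norm_Re lecR.
Qed.

End Nonnegative.

(** * The pole of the generating function at the Perron root *)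

Lemma poly_disk_bound (K : numFieldType) (f : {poly K}) (r : K) :
  exists2 M, 0 <= M & forall z, `|z| <= r -> `|f.[z]| <= M.
Proof.
exists (\sum_(i < size f) `|f`_i| * `|r| ^+ i).
  by apply: sumr_ge0 => i _; rewrite mulr_ge0 // exprn_ge0.
move=> z zr; rewrite horner_coef; apply: le_trans (ler_norm_sum _ _ _) _.
apply: ler_sum => i _; rewrite normrM normrX ler_wpM2l // lerXn2r ?nnegrE //.
by rewrite (ger0_norm (le_trans (normr_ge0 z) zr)).
Qed.

(** Near [th] a polynomial differs from its value at [th] by [O(t - th)]. *)
Lemma horner_eq0_right_limit (R : realType) (a b : {poly R[i]}) (th : R) :
    (forall t, th < t -> `|a.[t%:C]| <= (t - th)%:C * `|b.[t%:C]|) ->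
  a.[th%:C] = 0.
Proof.
move=> hab; apply/eqP/negPn/negP => ath.
have [a1 a1E] : exists a1, a - (a.[th%:C])%:P = a1 * ('X - (th%:C)%:P).
  by apply/factor_theorem; rewrite rootE hornerD hornerN hornerC subrr.
have [Ma Ma0 ha] := poly_disk_bound a1 (`|th| + 1)%:C.
have [Mb Mb0 hb] := poly_disk_bound b (`|th| + 1)%:C.
pose M := complex.Re `|Ma + Mb|.
have M0 : 0 <= M by rewrite -lecR norm_Re rmorph0.
pose e := complex.Re `|a.[th%:C]|.
have e0 : 0 < e by rewrite -ltcR norm_Re rmorph0 normr_gt0.
have eM : 0 < e + M by apply: ltr_wpDr.
(* With this [t] the bound [e <= (t - th) * M] fails, and [t <= th + 1]. *)
pose t := th + e / (e + M).
have tht : th < t by rewrite ltrDl divr_gt0.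
have tE : t - th = e / (e + M) by rewrite /t addrC addKr.
have tr : `|t%:C| <= (`|th| + 1)%:C.
  rewrite norm_real lecR; apply: le_trans (ler_normD _ _) _; rewrite lerD2l.
  by rewrite (ger0_norm (divr_ge0 (ltW e0) (ltW eM))) ler_pdivrMr // mul1r lerDl.
have : e%:C <= (t - th)%:C * M%:C.
  rewrite /e /M !norm_Re.
  have -> : a.[th%:C] = a.[t%:C] - (t - th)%:C * a1.[t%:C].
    have := congr1 (fun c => c.[t%:C]) a1E; rewrite !hornerE => e1.
    by rewrite rmorphB /= mulrC -e1 opprB addrC subrK.
  apply: le_trans (ler_normB _ _) _; apply: le_trans (lerD (hab t tht) (lexx _)) _.
  have t0 : 0 <= (t - th)%:C by rewrite -(rmorph0 (real_complex R)) lecR subr_ge0 ltW.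
  rewrite normrM (ger0_norm t0) -mulrDr ler_wpM2l // addrC.
  by rewrite (ger0_norm (addr_ge0 Ma0 Mb0)) lerD ?ha ?hb.
rewrite -rmorphM lecR tE mulrAC ler_pdivlMr // ler_pM2l // leNgt.
by rewrite ltrDr e0.
Qed.

Section PerronRoot.

Variables (R : realType) (q s : nat) (F : s.-tuple (seq 'I_q)).
Hypothesis hF : minimal_collection F.

Local Notation A := (adjacency_mx R F).
Local Notation p := (maxlen F).
Local Notation theta := (spectral_radius A).
Local Notation P := (count_char_poly R F).
Local Notation U := (avoiding_num R F).
Local Notation state := 'I_#|allowed_words F p.-1|.

Lemma adjacency_mx_ge0 : mx_ge0 A.
Proof. by move=> i j; rewrite mxE ler0n. Qed.

Lemma card_allowed_words_gt0 : (0 < #|allowed_words F p.-1|)%N.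
Proof.
have long n : exists2 w, size w = n & avoids F w.
  elim: n => [|n [w sw wF]]; first by exists [::] => //; apply: avoids_nil.
  have [c cF] := avoids_extend hF wF.
  by exists (rcons w c); rewrite ?size_rcons ?sw.
have [w sw wF] := long p.-1.
by have [i _] := allowed_word_onto hF sw wF; apply: leq_ltn_trans (ltn_ord i).
Qed.

Lemma adjacency_mx_row_ge1 (i : state) : 1 <= \sum_j A i j.
Proof.
have [c cF] := avoids_extend hF (allowed_word_avoids i).
have p1 : p.-1 = p.-2.+1 by case: (p) (maxlen_gt1 hF) => [|[]].
have [||j jE] := @allowed_word_onto _ _ hF (behead (rcons (allowed_word i) c)).
- by rewrite size_behead size_rcons size_allowed_word.
- by apply: avoids_infix cF; rewrite -drop1 infix_drop.
rewrite (bigD1 j) //=; suff -> : A i j = 1.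
  by rewrite lerDl sumr_ge0 // => k _; apply: adjacency_mx_ge0.
rewrite mxE jE; set u := allowed_word i in cF *.
have su : size u = p.-2.+1 by rewrite size_allowed_word.
case: u su cF => [//|d u] [su] cF; rewrite /= -cats1 -su.
rewrite take_size_cat // drop_size_cat // cats1.
by case: asboolP => // -[]; split=> //; apply/(allowedE hF).
Qed.

(** The column of ones is expanded by [1], as every allowed word can be
    continued. *)
Lemma spectral_radius_adjacency_ge1 : 1 <= theta.
Proof.
have [sb _] := spectral_radiusP A card_allowed_words_gt0.
rewrite leNgt; apply/negP => th1.
have one0 : const_mx 1 = 0 :> 'cV[R]_#|allowed_words F p.-1|.
  apply: (expanding_col_eq0 adjacency_mx_ge0 sb th1) => [i j|i].
    by rewrite mxE ler01.
  rewrite !mxE mulr1; apply: le_trans (adjacency_mx_row_ge1 i) _.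
  by apply: ler_sum => j _; rewrite !mxE mulr1.
have := congr1 (fun w : 'cV_ _ => w (Ordinal card_allowed_words_gt0) 0) one0.
by rewrite !mxE => /eqP; rewrite oner_eq0.
Qed.

(** The number of ways to continue a word ending in the state [i] by [m]
    letters. *)
Definition num_continuations (i : state) (m : nat) : R :=
  (A ^+ m *m const_mx 1 : 'cV_ _) i 0.

Lemma recurrence_num_continuations i : recurrence P (num_continuations i).
Proof.
apply: (@recurrence_mx _ _ _ (row i (A ^+ p)) (const_mx 1)) => m.
rewrite /num_continuations -row_mul -row_mul [RHS]mxE.
by rewrite exprD.
Qed.

(** By linearity and the shift rule, the vector of generating functions of the
    continuations, evaluated at [t], solves [(t - A) v = 1]. *)
Definition continuation_gf (t : R) : 'cV[R]_#|allowed_words F p.-1| :=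
  \col_i ((gf_num P (num_continuations i)).[t] / P.[t]).

Lemma continuation_gf_resolvent t i : P.[t] != 0 ->
  t * continuation_gf t i 0 = 1 + (A *m continuation_gf t) i 0.
Proof.
move=> Pt; have := gf_numS (recurrence_num_continuations i).
have -> : num_continuations i 0 = 1 by rewrite /num_continuations expr0 mul1mx mxE.
rewrite (@eq_gf_num _ _ _ (fun n => \sum_j A i j * num_continuations j n)); last first.
  by move=> n; rewrite /num_continuations exprS -mulmxA mxE.
rewrite gf_num_sum scale1r => /(congr1 (fun f : {poly R} => f.[t] / P.[t])).
rewrite horner_sum hornerD hornerN [('X * _).[t]]hornerM hornerX mulrBl (divff Pt) => e.
rewrite !mxE mulrA; apply/eqP; rewrite addrC -subr_eq -e mulr_suml; apply/eqP.
by apply: eq_bigr => j _; rewrite !mxE hornerZ mulrA.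
Qed.

(** The first [p - 1] terms of the generating function of [num_avoiding],
    multiplied by [X^(p-1)]. *)
Definition short_words_gf : {poly R} :=
  \sum_(m < p.-1) (num_avoiding F m)%:R *: 'X^(p.-2 - m).

Lemma horner_avoiding_num t : P.[t] != 0 ->
  t ^+ p.-1 * U.[t] =
  P.[t] * (\sum_i continuation_gf t i 0 + short_words_gf.[t]).
Proof.
move=> Pt; have := gf_num_shift p.-1 (recurrence_num_avoiding R hF).
rewrite (@eq_gf_num _ _ _ (fun n => \sum_i 1 * num_continuations i n)); last first.
  move=> n; rewrite addnC num_avoiding_transfer // -mulmxA mxE.
  by apply: eq_bigr => i _; congr (_ * _); rewrite mxE.
rewrite gf_num_sum -/U => /(congr1 (fun f : {poly R} => f.[t])).
rewrite -/short_words_gf hornerD hornerN [('X^_ * _).[t]]hornerM.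
rewrite [(short_words_gf * _).[t]]hornerM hornerXn => /eqP.
rewrite eq_sym subr_eq => /eqP ->; rewrite mulrDr [short_words_gf.[t] * _]mulrC.
congr (_ + _); rewrite horner_sum mulr_sumr; apply: eq_bigr => i _.
by rewrite scale1r mxE mulrC divfK.
Qed.

Lemma horner_short_words_gf_ge0 t : 0 <= t -> 0 <= short_words_gf.[t].
Proof.
move=> t0; rewrite /short_words_gf horner_sum sumr_ge0 // => m _.
by rewrite hornerZ hornerXn mulr_ge0 ?exprn_ge0.
Qed.

Lemma count_char_poly_neq0 t : theta < t -> P.[t] != 0.
Proof.
move=> tht; have [[th0 sb] _] := spectral_radiusP A card_allowed_words_gt0.
rewrite /count_char_poly hornerM hornerXn mulf_neq0 //.
  by rewrite expf_neq0 // gt_eqF // (le_lt_trans th0).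
apply/negP => /eqP rt; have /sb : root (char_poly (map_mx (real_complex R) A)) t%:C.
  by rewrite -map_char_poly /root horner_map rt rmorph0.
rewrite norm_real lecR => /(le_trans (ler_norm t)).
by rewrite leNgt tht.
Qed.

(** [t^(p-1) (t - theta) U(t) / P(t)], written so that the lower and upper bounds
    on it are visible. *)
Definition scaled_gf (t : R) : R :=
  (t - theta) * (\sum_i continuation_gf t i 0 + short_words_gf.[t]).

Lemma scaled_gfE t : theta < t ->
  (t - theta) * t ^+ p.-1 * U.[t] = scaled_gf t * P.[t].
Proof.
move=> tht; rewrite -mulrA horner_avoiding_num ?count_char_poly_neq0 //.
by rewrite /scaled_gf -!mulrA [P.[t] * _]mulrC.
Qed.

Lemma scaled_gf_ge1 t : theta < t -> 1 <= scaled_gf t.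
Proof.
move=> tht; have [sb [z rz zth]] := spectral_radiusP A card_allowed_words_gt0.
have th0 : 0 <= theta by case: sb.
have [y [yn0 y0 hy]] := subinvariant_row adjacency_mx_ge0 rz zth.
have hv i := continuation_gf_resolvent i (count_char_poly_neq0 tht).
have v0 := resolvent_ge0 adjacency_mx_ge0 sb tht hv.
rewrite /scaled_gf mulrDr; apply: ler_wpDr.
  apply: mulr_ge0; first by rewrite subr_ge0 ltW.
  by apply: horner_short_words_gf_ge0; apply: le_trans th0 (ltW tht).
exact: resolvent_sum_lower v0 tht hv yn0 y0 hy.
Qed.

Lemma scaled_gf_bounded : irreducible_mx A ->
  exists S : {poly R}, forall t, theta < t -> scaled_gf t <= S.[t].
Proof.
move=> irr; have [sb [z rz zth]] := spectral_radiusP A card_allowed_words_gt0.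
have [y [yn0 y0 hy]] := subinvariant_row adjacency_mx_ge0 rz zth.
have [x x0 hx] := positive_row adjacency_mx_ge0 sb irr yn0 y0 hy.
exists (((\sum_j x 0 j) * \sum_j (x 0 j)^-1)%:P + ('X - theta%:P) * short_words_gf).
move=> t tht; have hv i := continuation_gf_resolvent i (count_char_poly_neq0 tht).
have v0 := resolvent_ge0 adjacency_mx_ge0 sb tht hv.
rewrite /scaled_gf mulrDr !hornerE lerD2r.
exact: resolvent_sum_upper v0 tht hv x0 hx.
Qed.

Local Notation f := (forbidden_ratfun R[i] F).
Local Notation PC := (count_char_poly R[i] F).
Local Notation UC := (avoiding_num R[i] F).

Lemma map_adjacency_mx : map_mx (real_complex R) A = adjacency_mx R[i] F.
Proof. by apply/matrixP => i j; rewrite !mxE rmorph_nat. Qed.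

Lemma map_count_char_poly : PC = map_poly (real_complex R) P.
Proof.
by rewrite /count_char_poly rmorphM /= map_polyXn map_char_poly map_adjacency_mx.
Qed.

Lemma map_avoiding_num : UC = map_poly (real_complex R) U.
Proof.
rewrite /avoiding_num -map_gf_num map_count_char_poly; apply: eq_gf_num => n.
by rewrite rmorph_nat.
Qed.

Lemma complex_count_char_poly_neq0 : PC != 0.
Proof. by rewrite mulf_neq0 ?monic_neq0 ?char_poly_monic ?monicXn. Qed.

Lemma avoiding_num_neq0 : UC != 0.
Proof.
apply: contraTneq complex_count_char_poly_neq0 => U0.
have := forbidden_ratfun_avoiding R[i] hF.
by rewrite U0 /ratfun tofrac0 mul0r negbK => /esym/eqP; rewrite tofrac_eq0.
Qed.

Lemma reduced_form_forbidden n d : reduced_form f n d -> UC * n = PC * d.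
Proof.
case=> d0 _ fE; have := forbidden_ratfun_avoiding R[i] hF; rewrite fE /ratfun => e.
by apply/eqP; rewrite -tofrac_eq (tofracM UC) (tofracM PC) -e -mulrA divfK // tofrac_eq0.
Qed.

Lemma exists_reduced_form : exists n d, reduced_form f n d.
Proof.
pose g := gcdp UC PC.
have g0 : g != 0 by rewrite gcdp_eq0 (negbTE avoiding_num_neq0).
have UE : UC = UC %/ g * g by rewrite divpK // dvdp_gcdl.
have PE : PC = PC %/ g * g by rewrite divpK // dvdp_gcdr.
have d0 : UC %/ g != 0 by apply: contraNneq avoiding_num_neq0 => e; rewrite UE e mul0r.
exists (PC %/ g), (UC %/ g); split=> //.
  by rewrite coprimep_sym coprimep_div_gcd // avoiding_num_neq0.
have e := forbidden_ratfun_avoiding R[i] hF.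
apply: (@mulfI _ (ratfun UC)); first by rewrite tofrac_eq0 avoiding_num_neq0.
rewrite e mulrCA {1}UE {1}PE /ratfun !tofracM.
by rewrite [X in _ * (X / _)]mulrC mulfK ?tofrac_eq0 // mulrC.
Qed.

(** In reduced form [P / U = n / d], a root of [n] is a root of [P]. *)
Lemma zero_norm_le n d z : reduced_form f n d -> root n z -> `|z| <= theta%:C.
Proof.
move=> fE nz; have [[th0 sb] _] := spectral_radiusP A card_allowed_words_gt0.
have /(congr1 (fun g : {poly R[i]} => g.[z])) := reduced_form_forbidden fE.
case: fE => _ co _; rewrite (hornerM UC) (hornerM PC) (eqP nz) mulr0 => /esym/eqP.
rewrite mulf_eq0 (negbTE (coprimep_root co nz)) orbF.
rewrite /count_char_poly hornerM hornerXn mulf_eq0 => /orP[|].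
  by rewrite expf_eq0 => /andP[_ /eqP ->]; rewrite normr0 -(rmorph0 (real_complex R)) lecR.
by rewrite -map_adjacency_mx => /sb.
Qed.

(** The reduced quotient [d / n] is the generating function [U / P], so that this
    is [scaled_gfE] divided by [P(t)]. *)
Lemma reduced_form_scaled_gf n d t : reduced_form f n d -> theta < t ->
  (t - theta)%:C * ('X^(p.-1) * d).[t%:C] = (scaled_gf t)%:C * n.[t%:C].
Proof.
move=> fE tht.
have UP : U.[t]%:C * n.[t%:C] = P.[t]%:C * d.[t%:C].
  have := congr1 (fun g : {poly R[i]} => g.[t%:C]) (reduced_form_forbidden fE).
  rewrite (hornerM UC) (hornerM PC) map_avoiding_num map_count_char_poly.
  by rewrite !(horner_map (real_complex R)).
have : P.[t]%:C != 0 by rewrite fmorph_eq0 count_char_poly_neq0.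
have : (t - theta)%:C * t%:C ^+ p.-1 * U.[t]%:C = (scaled_gf t)%:C * P.[t]%:C.
  by rewrite -rmorphXn -!rmorphM scaled_gfE.
rewrite (hornerM 'X^(p.-1)) hornerXn; move: UP.
move: (U.[t]) (P.[t]) (scaled_gf t) => u v psi UP sE v0.
apply: (mulfI v0).
rewrite [LHS]mulrCA (mulrCA v%:C (t%:C ^+ _)) -UP !mulrA sE.
by rewrite [psi%:C * _]mulrC.
Qed.

(** As [scaled_gf t >= 1], the equality bounds [n(t)] by a multiple of
    [t - theta]. *)
Lemma root_reduced_form n d : reduced_form f n d -> root n theta%:C.
Proof.
move=> fE; apply/eqP; apply: (@horner_eq0_right_limit _ _ ('X^(p.-1) * d)) => t tht.
have tth0 : 0 <= (t - theta)%:C.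
  by rewrite -(rmorph0 (real_complex R)) lecR subr_ge0 ltW.
rewrite -[X in X * _](ger0_norm tth0) -normrM (reduced_form_scaled_gf fE tht).
rewrite normrM ler_peMl // norm_real -(rmorph1 (real_complex R)) lecR.
by apply: le_trans (scaled_gf_ge1 tht) (ler_norm _).
Qed.

(** If [n] had a double zero, the boundedness of [scaled_gf] would bound [d(t)] by a
    multiple of [t - theta], and [d] would vanish at [theta] as well. *)
Lemma mup_reduced_form n d : irreducible_mx A -> reduced_form f n d ->
  n != 0 -> mup theta%:C n = 1%N.
Proof.
move=> irr fE n0; have nth := root_reduced_form fE.
have [S hS] := scaled_gf_bounded irr.
apply/eqP; rewrite eqn_leq mup_geq // expr1 dvdp_XsubCl nth andbT leqNgt; apply/negP => m2.
have /dvdpP[m mE] : ('X - (theta%:C)%:P) ^+ 2 %| n.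
  by rewrite -mup_geq.
have th0 : 0 < theta by apply: lt_le_trans ltr01 spectral_radius_adjacency_ge1.
have : ('X^(p.-1) * d).[theta%:C] = 0.
  apply: (@horner_eq0_right_limit _ _ (map_poly (real_complex R) S * m)) => t tht.
  have tth : (t - theta)%:C != 0 by rewrite fmorph_eq0 subr_eq0 gt_eqF.
  have tth0 : 0 <= (t - theta)%:C.
    by rewrite -(rmorph0 (real_complex R)) lecR subr_ge0 ltW.
  have -> : ('X^(p.-1) * d).[t%:C] = (t - theta)%:C * ((scaled_gf t)%:C * m.[t%:C]).
    apply: (mulfI tth); rewrite (reduced_form_scaled_gf fE tht) mE (hornerM m) horner_exp.
    have w : t%:C - theta%:C = (t - theta)%:C by rewrite rmorphB.
    rewrite hornerXsubC w.
    move: (scaled_gf t)%:C (m.[t%:C]) (t - theta)%:C => x y z.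
    by rewrite [y * _]mulrC mulrCA expr2 -mulrA.
  rewrite normrM (ger0_norm tth0) ler_wpM2l // hornerM horner_map !normrM.
  rewrite ler_wpM2r // !norm_real lecR.
  have psi0 : 0 <= scaled_gf t by apply: le_trans ler01 (scaled_gf_ge1 tht).
  by rewrite ger0_norm //; apply: le_trans (hS t tht) (ler_norm _).
case: fE => _ co _; apply/eqP; rewrite hornerM hornerXn mulf_neq0 //.
  by rewrite expf_neq0 // fmorph_eq0 gt_eqF.
exact: coprimep_root co nth.
Qed.

End PerronRoot.

Theorem theorem1 (R : realType) (q : nat) (hq : (2 <= q)%N)
    (s : nat) (F : s.-tuple (seq 'I_q)) (hF : minimal_collection F) :
  let A := adjacency_mx R F in
  let theta := spectral_radius A in
  let f := forbidden_ratfun R[i] F in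
  [/\ [/\ 0 < theta, is_zero_of f theta%:C
        & forall t : R, 0 < t -> is_zero_of f t%:C -> t <= theta],
      forall z : R[i], is_zero_of f z -> `|z| <= theta%:C
    & irreducible_mx A -> is_simple_zero_of f theta%:C].
Proof.
move=> A theta f.
have [n [d fE]] := exists_reduced_form R hF.
have disk z : is_zero_of f z -> `|z| <= theta%:C.
  by case=> n' [d' [f'E]]; apply: zero_norm_le f'E.
have th1 : 1 <= theta by apply: spectral_radius_adjacency_ge1.
split=> //; first split.
- exact: lt_le_trans ltr01 th1.
- by exists n, d; split=> //; apply: root_reduced_form fE.
- move=> t t0 /disk; rewrite norm_real lecR; exact: le_trans (ler_norm t).
move=> irr; have n0 : n != 0.
  have := reduced_form_forbidden hF fE; apply: contra_eq_neq => ->.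
  by rewrite mulr0 eq_sym mulf_neq0 ?complex_count_char_poly_neq0 //; case: fE.
by exists n, d; split=> //; apply: mup_reduced_form fE n0.
Qed.
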